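(* Let $b\ge 2$ and $N\ge 1$ be integers and let $\xi\neq 1$ be a complex number with $\xi^b=1$. Let $f$ be any polynomial (with complex coefficients) of degree $<N$. Then for all $x,y\in\mathbb{C}$, $$\sum_{n=0}^{b^N-1}\xi^{s_b(n)} f\left(s_b(n)x+ny\right) = 0.$$
   Context: For a nonnegative integer $n$, $s_b(n)$ denotes the sum of the digits of $n$ in base $b$. *)

(* Defs.v *)
From mathcomp Require Import all_boot.

Set Implicit Arguments.
Unset Strict Implicit.
Unset Printing Implicit Defensive.

(* The coefficient of b ^ i in the base-b expansion of n, for b >= 2. *)
Definition digit (b n i : nat) : nat := (n %/ b ^ i) %% b.

(* The positions i < n suffice: if b >= 2 then n < b ^ n, so digit b n i = 0
   for every i >= n. *)
Definition digit_sum (b n : nat) : nat := \sum_(i < n) digit b n i.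

(* Main.v *)
Require Import Defs.
From mathcomp Require Import all_boot all_order all_algebra.
From mathcomp Require Import reals.
From mathcomp Require Import complex.

(** Splitting off the lowest digit, n = m * b + d, gives s_b(n) = s_b(m) + d and
    turns the argument s_b(n) x + n y into s_b(m) x + m (b y) + d (x + y).
    Summing over d first therefore leaves a sum of the same shape over
    m < b ^ (N - 1), in which y has become b y and f has become
      g = sum_(d < b) xi^d f(X + d (x + y)).
    All translates of f share its leading coefficient, and the weights xi^d add
    up to (xi^b - 1) / (xi - 1) = 0, so the leading terms cancel and
    deg g < deg f ([size_weighted_translates]).  Each of the N digits lowers the
    degree by at least one, so after N steps nothing is left of a polynomial of
    degree < N.  The argument is algebraic and works over any integral domain
    ([digit_sum_weighted_sum_eq0]). *)

Set Implicit Arguments.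
Unset Strict Implicit.
Unset Printing Implicit Defensive.

Import Order.TTheory GRing.Theory Num.Theory.
Local Open Scope ring_scope.
Local Open Scope complex_scope.

Lemma digit_eq0 (b n i : nat) : (1 < b)%N -> (n <= i)%N -> digit b n i = 0%N.
Proof.
move=> b_gt1 le_ni; rewrite /digit divn_small ?mod0n //.
exact: leq_ltn_trans le_ni (ltn_expl i b_gt1).
Qed.

(** Any sufficiently long range of positions computes the digit sum; this lets
    the digit sums of two different numbers be compared position by position. *)
Lemma digit_sum_widen (b n k : nat) : (1 < b)%N -> (n <= k)%N ->
  digit_sum b n = (\sum_(i < k) digit b n i)%N.
Proof.
move=> b_gt1 le_nk; rewrite /digit_sum -!(big_mkord xpredT).
rewrite (big_cat_nat (leq0n n) le_nk) /= [X in (_ + X)%N]big1_seq ?addn0 // => i.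
by rewrite mem_index_iota => /andP[_ /andP[le_ni _]]; apply: digit_eq0.
Qed.

Lemma digit_sumD (b m d : nat) : (1 < b)%N -> (d < b)%N ->
  digit_sum b (m * b + d) = (digit_sum b m + d)%N.
Proof.
move=> b_gt1 lt_db; have b_gt0 : (0 < b)%N by apply: ltnW.
have le_m : (m <= m * b + d)%N.
  by apply: leq_trans (leq_addr _ _); rewrite leq_pmulr.
rewrite (digit_sum_widen b_gt1 (leqnSn _)) (digit_sum_widen b_gt1 le_m).
rewrite big_ord_recl addnC; congr (_ + _)%N.
  apply: eq_bigr => i _; rewrite /digit lift0 expnS divnMA.
  by rewrite divnMDl // (divn_small lt_db) addn0.
by rewrite /digit expn0 divn1 modnMDl modn_small.
Qed.

Lemma sum_expr_unity_root (R : idomainType) (b : nat) (xi : R) :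
  xi != 1 -> xi ^+ b = 1 -> \sum_(d < b) xi ^+ d = 0.
Proof.
move=> xi_neq1 xi_b; have /esym/eqP := subrX1 xi b.
by rewrite xi_b subrr mulf_eq0 subr_eq0 (negPf xi_neq1) => /eqP.
Qed.

Lemma coef_translate_top (R : idomainType) (f : {poly R}) (a : R) (n : nat) :
  (size f <= n.+1)%N -> (f \Po ('X + a%:P))`_n = f`_n.
Proof.
have sizeXa : size ('X + a%:P) = 2 by rewrite size_XaddC.
rewrite leq_eqVlt => /orP[/eqP sz_f | lt_fn].
  have := @lead_coef_comp _ f ('X + a%:P); rewrite sizeXa => /(_ isT).
  rewrite lead_coefXaddC expr1n mulr1 !lead_coefE size_comp_poly2 //.
  by rewrite sz_f.
by rewrite !nth_default // size_comp_poly2.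
Qed.

(** A combination of translates of f with weights of sum zero drops the degree:
    it behaves as a finite difference, since the top coefficient of f is
    translation invariant. *)
Lemma size_weighted_translates (R : idomainType) (b n : nat) (c a : 'I_b -> R)
    (f : {poly R}) :
  \sum_d c d = 0 -> (size f <= n.+1)%N ->
  (size (\sum_d c d *: (f \Po ('X + (a d)%:P)))%R <= n)%N.
Proof.
move=> sum_c sz_f; apply/leq_sizeP => j; rewrite leq_eqVlt coef_sum.
case/orP=> [/eqP <- | lt_nj].
  under eq_bigr => d _ do rewrite coefZ coef_translate_top //.
  by rewrite -mulr_suml sum_c mul0r.
rewrite big1 // => d _; rewrite coefZ nth_default ?mulr0 //.
by rewrite size_comp_poly2 ?size_XaddC // (leq_trans sz_f).
Qed.

(** Here [f] and [y] vary along the induction on the number of digits, and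
    N = 0 is an admissible start: it forces f = 0. *)
Lemma digit_sum_weighted_sum_eq0 (R : idomainType) (b N : nat) (xi : R)
    (f : {poly R}) (x y : R) :
  (1 < b)%N -> xi != 1 -> xi ^+ b = 1 -> (size f <= N)%N ->
  \sum_(0 <= n < (b ^ N)%N)
     xi ^+ digit_sum b n * f.[(digit_sum b n)%:R * x + n%:R * y] = 0.
Proof.
move=> b_gt1 xi_neq1 xi_b; elim: N f y => [|N IHN] f y sz_f.
  have /eqP -> : f == 0 by rewrite -size_poly_leq0.
  by rewrite big1 // => n _; rewrite horner0 mulr0.
pose g : {poly R} := \sum_(d < b) xi ^+ d *: (f \Po ('X + (d%:R * (x + y))%:P)).
have sz_g : (size g <= N)%N.
  by apply: size_weighted_translates sz_f; apply: sum_expr_unity_root.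
rewrite -[RHS](IHN g (b%:R * y) sz_g) expnSr big_nat_mul.
apply: eq_bigr => m _.
rewrite -{1}[(m * b)%N]add0n big_addn mulSn addnK big_mkord.
rewrite horner_sum mulr_sumr; apply: eq_bigr => d _.
rewrite addnC digit_sumD // exprD hornerZ horner_comp !hornerE.
congr (_ * f.[_]).
rewrite !natrD natrM !mulrDl mulrDr /=.
by rewrite addrACA.
Qed.

(* MathComp; the complex numbers are R[i] for R : realType. *)
Theorem theorem5 (R : realType) (b N : nat) (hb : (2 <= b)%N) (hN : (1 <= N)%N)
    (xi : R[i]) (hxi1 : xi != 1) (hxi : xi ^+ b = 1)
    (f : {poly R[i]}) (hf : (size f <= N)%N) (x y : R[i]) :
  \sum_(0 <= n < (b ^ N)%N)
     xi ^+ digit_sum b n * f.[(digit_sum b n)%:R * x + n%:R * y] = 0.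
Proof. exact: digit_sum_weighted_sum_eq0. Qed.
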